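(* Let $m\ge 3$, $s=\lfloor (m-1)/2\rfloor$ and $t=\lfloor (m+2)/2\rfloor$, so that $m=s+t$. For $c,\alpha\in\mathbb{F}_2^t$ let $S_{c,\alpha}$ be the set of $(1,-1)$-sequences of length $2^m$ defined in the context. Then: (i) For all $c,\alpha\in\mathbb{F}_2^t$, all the sequences in $S_{c,\alpha}$ are semi-bent sequences. (ii) For any fixed $c,\alpha\in\mathbb{F}_2^t$, $S_{c,\alpha}$ is a set of orthogonal sequences. (iii) For any $c\neq e$ in $\mathbb{F}_2^t$ and any $\alpha,\delta\in\mathbb{F}_2^t$, $S_{c,\alpha}\perp S_{e,\delta}$ if and only if $$\pi^{-1}(\alpha+\delta)\notin\{\gamma^{[y]+i_{c+e}} \mid y\in\mathbb{F}_2^s\}.$$ In particular, $S_{c,\alpha}\perp S_{e,\delta}$ when $c\ne e$ and $\alpha=\delta$. In addition, for a fixed $c\in\mathbb{F}_2^t$, $S_{c,\alpha}\perp S_{c,\alpha'}$ whenever $\alpha\neq\alpha'$. (iv) For any fixed $e,\delta\in\mathbb{F}_2^t$, there exist $M$ sets in $\{S_{c,\alpha}\mid c,\alpha\in\mathbb{F}_2^t\}$ which are orthogonal to $S_{e,\delta}$, where $$M=\begin{cases}2^m+2^{(m-1)/2}-1, & m \text{ odd},\\ 3\cdot 2^m+2^{m/2-1}-1, & m\text{ even}.\end{cases}$$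
   Context: Boolean functions and sequences. $\mathcal{B}_m$ denotes the set of functions $f:\mathbb{F}_2^m\to\mathbb{F}_2$. For $a,b\in\mathbb{F}_2^n$, $a\cdot b=\sum_i a_ib_i\in\mathbb{F}_2$. The Walsh–Hadamard transform of $f\in\mathcal{B}_m$ is $W_f(\omega)=\sum_{x\in\mathbb{F}_2^m}(-1)^{f(x)+\omega\cdot x}$. The function $f$ is semi-bent if $W_f(\omega)\in\{0,\pm 2^{\lambda}\}$ for all $\omega\in\mathbb{F}_2^m$, with $\lambda=\lfloor (m+2)/2\rfloor$. The sequence of $f\in\mathcal{B}_m$ is the $(1,-1)$-sequence $\overline{f}=((-1)^{f(x)})_{x\in\mathbb{F}_2^m}$ of length $2^m$; it is a semi-bent sequence if $f$ is semi-bent. Sequences $\overline{f_1},\overline{f_2}$ are orthogonal if $\overline{f_1}\cdot\overline{f_2}=\sum_{x}(-1)^{f_1(x)+f_2(x)}=0$ (as an integer). A set of orthogonal sequences is a set of pairwise orthogonal sequences. For two sets of orthogonal sequences, $S_1\perp S_2$ (''$S_1$ is orthogonal to $S_2$'') means that every sequence of $S_1$ is orthogonal to every sequence of $S_2$. Componentwise product: $\overline{f_1}*\overline{f_2}=\overline{f_1+f_2}$. Construction. Let $\gamma$ be a primitive element of $\mathbb{F}_{2^t}$ and let $\pi:\mathbb{F}_{2^t}\to\mathbb{F}_2^t$ be the linear isomorphism $\pi(b_1+b_2\gamma+\cdots+b_t\gamma^{t-1})=(b_1,\dots,b_t)$. For $y\in\mathbb{F}_2^s$ let $[y]=\sum_{j=1}^s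 y_j2^{j-1}$ (an integer). For $i=1,\dots,t$ define $f_i:\mathbb{F}_2^s\times\mathbb{F}_2^t\to\mathbb{F}_2$ by $f_i(y,x)=\pi(\gamma^{[y]+i})\cdot x$. For $c\in\mathbb{F}_2^t$ let $f_c=c_1f_1+\cdots+c_tf_t$. For $\alpha\in\mathbb{F}_2^t$ let $L_\alpha=\{\,l_\beta(y,x)=\beta\cdot y+\alpha\cdot x\mid \beta\in\mathbb{F}_2^s\}$. Define $$S_{c,\alpha}=\{\overline{f_c}*\overline{l}\mid l\in L_\alpha\},\qquad c,\alpha\in\mathbb{F}_2^t.$$ For nonzero $c\in\mathbb{F}_2^t$, $i_c\in\{0,\dots,2^t-2\}$ is the exponent determined by $\gamma^{i_c}=c_1\gamma+c_2\gamma^2+\cdots+c_t\gamma^t$.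
   Formalization: Part (i) is stated for nonzero c only: for c = 0 the sequences in S_{0,α} are those of linear functions, whose Walsh–Hadamard transform takes the value 2^m, so they are not semi-bent for m ≥ 3. *)

(* Defs.v *)
From mathcomp Require Import all_boot all_order all_algebra all_field.
From mathcomp Require Import finmap.

Set Implicit Arguments.
Unset Strict Implicit.
Unset Printing Implicit Defensive.

Import GRing.Theory.

Local Open Scope ring_scope.

Definition boolfun (n : nat) := {ffun 'rV['F_2]_n -> 'F_2}.

Definition sequence (n : nat) := {ffun 'rV['F_2]_n -> int}.

Definition dotp (n : nat) (a b : 'rV['F_2]_n) : 'F_2 :=
  \sum_(i < n) a 0 i * b 0 i.

Definition sgn (b : 'F_2) : int := (-1) ^+ (b : nat).

Definition walsh (n : nat) (f : boolfun n) (w : 'rV['F_2]_n) : int :=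
  \sum_(x : 'rV['F_2]_n) sgn (f x + dotp w x).

Definition semi_bent (n : nat) (f : boolfun n) : Prop :=
  forall w : 'rV['F_2]_n,
    walsh f w \in [:: 0; 2 ^+ (n.+2)./2; - 2 ^+ (n.+2)./2].

Definition seq_of (n : nat) (f : boolfun n) : sequence n :=
  [ffun x => sgn (f x)].

Definition semi_bent_seq (n : nat) (u : sequence n) : Prop :=
  exists2 f : boolfun n, u = seq_of f & semi_bent f.

Definition seq_mul (n : nat) (u v : sequence n) : sequence n :=
  [ffun x => u x * v x].

Definition orthogonal_seq (n : nat) (u v : sequence n) : bool :=
  \sum_(x : 'rV['F_2]_n) u x * v x == 0.

Definition orthogonal_set (n : nat) (A : {fset sequence n}) : Prop :=
  {in A &, forall u v, u != v -> orthogonal_seq u v}.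

Definition perp (n : nat) (A B : {fset sequence n}) : bool :=
  [forall u : A, forall v : B, orthogonal_seq (val u) (val v)].

(* [y], with coordinates numbered from 0 *)
Definition nat_of_vec (s : nat) (y : 'rV['F_2]_s) : nat :=
  (\sum_(j < s) y 0%R j * 2 ^ j)%N.

Section Construction.

(* L plays the role of F_{2^t} (when its dimension over F_2 is t) and g that of
   the primitive element. F_2^s x F_2^t is represented by 'rV_(s + t): the left
   block of a vector is y and the right block is x. *)
Variables (L : fieldExtType 'F_2) (s t : nat) (g : L).

Definition pow_basis : t.-tuple L := [tuple g ^+ i | i < t].

Definition Pi (z : L) : 'rV['F_2]_t := \row_(i < t) coord pow_basis i z.

Definition Pi_inv (b : 'rV['F_2]_t) : L := \sum_(i < t) b 0 i *: g ^+ i.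

(* The indices i of f_i, c_i are shifted: i : 'I_t stands for i + 1. *)
Definition f_ (i : 'I_t) : boolfun (s + t) :=
  [ffun z => dotp (Pi (g ^+ (nat_of_vec (lsubmx z) + i.+1))) (rsubmx z)].

Definition f_lin (c : 'rV['F_2]_t) : boolfun (s + t) :=
  [ffun z => \sum_(i < t) c 0 i * f_ i z].

Definition lin (b : 'rV['F_2]_s) (a : 'rV['F_2]_t) : boolfun (s + t) :=
  [ffun z => dotp b (lsubmx z) + dotp a (rsubmx z)].

Definition L_set (a : 'rV['F_2]_t) : {set boolfun (s + t)} :=
  [set lin b a | b : 'rV['F_2]_s].

Definition S_set (c a : 'rV['F_2]_t) : {fset sequence (s + t)} :=
  [fset seq_mul (seq_of (f_lin c)) (seq_of l) | l in L_set a]%fset.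

Definition S_family : {fset {fset sequence (s + t)}} :=
  [fset S_set p.1 p.2 | p in [set: 'rV['F_2]_t * 'rV['F_2]_t]]%fset.

(* The exponent i_c in {0, .., 2^t - 2}, meaningful for c != 0; it is the
   (out of range) value 2^t - 1 if there is no such exponent. *)
Definition i_ (c : 'rV['F_2]_t) : nat :=
  index (\sum_(i < t) c 0 i *: g ^+ i.+1)
        [seq g ^+ k | k <- iota 0 (2 ^ t).-1].

(* The set {g^([y] + k) | y in F_2^s}, as a sequence. *)
Definition pow_set (k : nat) : seq L :=
  [seq g ^+ (nat_of_vec y + k) | y : 'rV['F_2]_s].

End Construction.

Lemma pow_basisP (L : fieldExtType 'F_2) (t : nat) (g : L) :
    \dim {:L} = t -> ((2 ^ t).-1).-primitive_root g ->
  basis_of {:L} (pow_basis t g).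
Proof.
move=> dimL prim_g.
have t_gt0 : (0 < t)%N by rewrite -dimL adim_gt0.
set n := (2 ^ t).-1 in prim_g.
have n_gt0 : (0 < n)%N by rewrite (prim_order_gt0 prim_g).
have g_unit : g != 0.
  apply/eqP=> g0; have := prim_expr_order prim_g.
  by rewrite g0 expr0n gtn_eqF //= => /eqP; rewrite eq_sym oner_eq0.
pose X : {set finvect_type L} := [set (g ^+ (i : 'I_n) : finvect_type L) | i : 'I_n].
have cardX : #|X| = n.
  rewrite card_imset ?card_ord // => i j /= /eqP.
  by rewrite (eq_prim_root_expr prim_g) !modn_small // => /eqP /val_inj.
have cardL : #|{: finvect_type L}| = (2 ^ t)%N.
  have := card_vspace (fullv : {vspace (finvect_type L)}).
  rewrite card_Fp // -[\dim _]/(\dim {:L}) dimL => <-.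
  by apply: eq_card => z; rewrite memvf.
have defX : X = [set~ (0 : finvect_type L)].
  apply/eqP; rewrite eqEcard; apply/andP; split.
    by apply/subsetP=> z /imsetP[i _ ->]; rewrite !inE expf_neq0.
  by rewrite cardsC1 cardL cardX.
have powL (z : L) : z != 0 -> exists k, z = g ^+ k.
  move=> nz; have: (z : finvect_type L) \in X by rewrite defX !inE.
  by case/imsetP=> k _ ->; exists k.
have defL : <<1%VS; g>>%VS = {:L}%VS.
  apply/eqP; rewrite eqEsubv subvf; apply/subvP=> z _.
  have [->|/powL[k ->]] := eqVneq z 0; first exact: mem0v.
  by rewrite rpredX // memv_adjoin.
have dg : adjoin_degree 1 g = t.
  by apply/eqP; have := dim_Fadjoin 1%AS g; rewrite defL dimL dimv1 muln1 => <-.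
rewrite basisEdim size_tuple dimL leqnn andbT.
apply/subvP=> z _.
have: z \in <<1%VS; g>>%VS by rewrite defL memvf.
case/Fadjoin_polyP=> p /polyOverP p1; move=> ->.
have [q [qs qE]]: exists q : {poly L}, (size q <= t)%N /\ (q \is a polyOver 1%VS) /\ q.[g] = p.[g].
  have zin: p.[g] \in <<1%VS; g>>%VS by rewrite defL memvf.
  exists (Fadjoin_poly 1%AS g p.[g]); rewrite -{1}dg size_Fadjoin_poly; split=> //.
  by rewrite Fadjoin_polyOver Fadjoin_poly_eq.
case: qE => /polyOverP q1 <-.
rewrite (horner_coef_wide _ qs) rpred_sum // => i _.
have /vlineP[k ->] := q1 i.
rewrite -scalerAl mul1r rpredZ // memv_span //.
by apply/tnthP; exists i; rewrite tnth_mktuple.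
Qed.

(* Pi is the isomorphism of the construction and Pi_inv is its inverse. *)
Lemma Pi_invK (L : fieldExtType 'F_2) (t : nat) (g : L) :
    \dim {:L} = t -> ((2 ^ t).-1).-primitive_root g ->
  cancel (@Pi_inv L t g) (@Pi L t g).
Proof.
move=> dimL prim_g b; apply/rowP=> i; rewrite mxE.
have /andP[_ freeX] := pow_basisP dimL prim_g.
rewrite -[RHS](coord_sum_free (b 0) i freeX); congr (coord _ _ _).
by apply: eq_bigr => j _; rewrite -tnth_nth tnth_mktuple.
Qed.

Lemma PiK (L : fieldExtType 'F_2) (t : nat) (g : L) :
    \dim {:L} = t -> ((2 ^ t).-1).-primitive_root g ->
  cancel (@Pi L t g) (@Pi_inv L t g).
Proof.
move=> dimL prim_g z.
rewrite [RHS](coord_basis (pow_basisP dimL prim_g) (memvf z)).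
by apply: eq_bigr => j _; rewrite -tnth_nth tnth_mktuple mxE.
Qed.

(* Main.v *)
Require Import Defs.
From mathcomp Require Import all_boot all_order all_algebra all_field.
From mathcomp Require Import finmap.
From mathcomp Require Import zify.

Set Implicit Arguments.
Unset Strict Implicit.
Unset Printing Implicit Defensive.

Import GRing.Theory.

Local Open Scope ring_scope.

(* For fixed y the function f_c(y, x) is the linear form mult c y of x, where
   mult c y = Pi (g^([y]) * g * Pi_inv c). Summing first over x, the correlation
   of f_c with the linear function (b, a) is 2^t times the sum of (-1)^(b . y)
   over those y with mult c y = a. Since 2^s < 2^t, y |-> mult c y is injective
   for c != 0, so that sum has at most one term: the correlation is 0 or +-2^t,
   and it vanishes exactly when a is not of the form mult c y. Everything
   reduces to this, because f_c is additive in c. In (iv), S_{e,delta} is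
   orthogonal to 2^t - 2^s of the S_{c,alpha} for each c != e and to 2^t - 1 of
   those with c = e. *)

(** * Arithmetic in characteristic two *)

Lemma F2_cases (b : 'F_2) : b = 0 \/ b = 1.
Proof. by case: b => [[|[|//]]] ?; [left | right]; apply/val_inj. Qed.

Lemma oppr_F2 (V : lmodType 'F_2) (v : V) : - v = v.
Proof. by rewrite -scaleN1r (_ : -1 = 1) ?scale1r //; apply/val_inj. Qed.

Lemma addrr_F2 (V : lmodType 'F_2) (v : V) : v + v = 0.
Proof. by rewrite -{2}[v]oppr_F2 subrr. Qed.

Lemma addr_eq0_F2 (V : lmodType 'F_2) (u v : V) : (u + v == 0) = (u == v).
Proof. by rewrite addr_eq0 oppr_F2. Qed.

Lemma addrK_F2 (V : lmodType 'F_2) (v : V) : involutive (+%R^~ v).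
Proof. by move=> u; rewrite /= -addrA addrr_F2 addr0. Qed.

Lemma card_rVF2 n : #|{: 'rV['F_2]_n}| = (2 ^ n)%N.
Proof. by rewrite card_mx card_ord mul1n. Qed.

(** * Signs, dot products and character sums *)

Lemma sgnD : {morph sgn : a b / a + b >-> a * b}.
Proof. by move=> a b; case: (F2_cases a) => ->; case: (F2_cases b) => ->. Qed.

Lemma sgn_cases b : sgn b = 1 \/ sgn b = -1.
Proof. by case: (F2_cases b) => ->; [left | right]. Qed.

Lemma dotpDl n (a b x : 'rV['F_2]_n) : dotp (a + b) x = dotp a x + dotp b x.
Proof.
by rewrite /dotp -big_split; apply: eq_bigr => i _; rewrite mxE mulrDl.
Qed.

Lemma dotpC n (a b : 'rV['F_2]_n) : dotp a b = dotp b a.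
Proof. by apply: eq_bigr => i _; rewrite mulrC. Qed.

Lemma dotpDr n (a x y : 'rV['F_2]_n) : dotp a (x + y) = dotp a x + dotp a y.
Proof. by rewrite dotpC dotpDl !(dotpC a). Qed.

Lemma dotp_delta n (a : 'rV['F_2]_n) i : dotp a (delta_mx 0 i) = a 0 i.
Proof.
rewrite /dotp (bigD1 i) //= mxE !eqxx mulr1 big1 ?addr0 // => j ji.
by rewrite mxE (negbTE ji) andbF mulr0.
Qed.

(** If [a 0 i = 1], translating [x] by the i-th unit vector flips the sign of every term, so the sum
    equals its own opposite. *)
Lemma sum_sgn_dotp n (a : 'rV['F_2]_n) :
  \sum_(x : 'rV['F_2]_n) sgn (dotp a x) = if a == 0 then 2 ^+ n else 0.
Proof.
have [->|a_neq0] := eqVneq a 0.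
  rewrite (eq_bigr (fun=> 1)) => [|x _].
    by rewrite sumr_const card_rVF2 natrX.
  by rewrite /dotp big1 // => i _; rewrite mxE mul0r.
have [i ai] : exists i, a 0 i != 0.
  apply/existsP; apply: contraR a_neq0; rewrite negb_exists => /forallP a0.
  by apply/eqP/rowP=> i; rewrite mxE; apply/eqP; rewrite -[_ == _]negbK a0.
have {}ai : a 0 i = 1 by case: (F2_cases (a 0 i)) ai => ->.
set S := \sum_x _.
suff : S = - S by lia.
rewrite {1}/S (reindex_inj (addIr (delta_mx 0 i))) -sumrN.
by apply: eq_bigr => x _; rewrite dotpDr dotp_delta ai sgnD mulrN1.
Qed.

Lemma sum_row_mx n1 n2 (F : 'rV['F_2]_(n1 + n2) -> int) :
  \sum_z F z = \sum_y \sum_x F (row_mx y x).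
Proof.
rewrite pair_big /= (reindex (fun p => row_mx p.1 p.2)) //=.
exists (fun z => (lsubmx z, rsubmx z)) => [[y x] _|z _] /=.
  by rewrite row_mxKl row_mxKr.
by rewrite hsubmxK.
Qed.

(** * Binary expansions *)

Lemma nat_of_vecS n (y : 'rV['F_2]_n.+1) :
  nat_of_vec y = (y 0%R ord0 + 2 * nat_of_vec (\row_i y 0%R (lift ord0 i)))%N.
Proof.
rewrite /nat_of_vec big_ord_recl expn0 muln1 big_distrr /=; congr addn.
by apply: eq_bigr => i _; rewrite mxE expnS mulnCA.
Qed.

Lemma F2_lt2 (b : 'F_2) : (b < 2)%N.
Proof. by case: b. Qed.

Lemma nat_of_vec_lt n (y : 'rV['F_2]_n) : (nat_of_vec y < 2 ^ n)%N.
Proof.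
elim: n => [|n IHn] in y *; first by rewrite /nat_of_vec big_ord0.
have := IHn (\row_i y 0 (lift ord0 i)); have := F2_lt2 (y 0 ord0).
rewrite nat_of_vecS expnS; move: (nat_of_vec _) (2 ^ n)%N (nat_of_ord _).
move=> k N b; lia.
Qed.

Lemma nat_of_vec_inj n : injective (@nat_of_vec n).
Proof.
elim: n => [y z _|n IHn y z]; first by apply/rowP; case.
rewrite !nat_of_vecS => yz.
have digits (b b' : 'F_2) k k' : (b + 2 * k = b' + 2 * k')%N -> b = b' /\ k = k'.
  move=> bk; have lb := F2_lt2 b; have lb' := F2_lt2 b'.
  split; [apply/val_inj => /= | ]; move: bk lb lb';
    move: (nat_of_ord b) (nat_of_ord b') => j j'; lia.
have [y0 /IHn/rowP yS] := digits _ _ _ _ yz.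
apply/rowP=> i; case: (unliftP ord0 i) => [j|] -> //.
by have := yS j; rewrite !mxE.
Qed.

(** * The linear forms x |-> f_c(y, x) *)

Section Correlation.

Variables (L : fieldExtType 'F_2) (s t : nat) (g : L).
Hypotheses (dimL : \dim {:L} = t) (prim_g : ((2 ^ t).-1).-primitive_root g).
Hypothesis (st : (s < t)%N).

Implicit Types (c e a d : 'rV['F_2]_t) (b y : 'rV['F_2]_s).

Local Notation S := (@S_set L s t g).
Local Notation fc := (@f_lin L s t g).

Lemma prim_neq0 : g != 0.
Proof.
apply/eqP=> g0; have := prim_expr_order prim_g.
rewrite g0 expr0n gtn_eqF ?(prim_order_gt0 prim_g) // => /eqP.
by rewrite eq_sym oner_eq0.
Qed.

Lemma Pi_inv_inj : injective (@Pi_inv L t g).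
Proof. exact: can_inj (Pi_invK dimL prim_g). Qed.

Lemma Pi_inv0 : Pi_inv g (0 : 'rV['F_2]_t) = 0.
Proof. by rewrite /Pi_inv big1 // => i _; rewrite mxE scale0r. Qed.

Lemma Pi_inv_eq0 c : (Pi_inv g c == 0) = (c == 0).
Proof. by rewrite -Pi_inv0 (inj_eq Pi_inv_inj). Qed.

Lemma Pi_inj : injective (@Pi L t g).
Proof. exact: can_inj (PiK dimL prim_g). Qed.

(* For c != 0 this is Pi (g ^+ (nat_of_vec y + i_ g c)). *)
Definition mult c y : 'rV['F_2]_t :=
  Pi t g (g ^+ nat_of_vec y * (g * Pi_inv g c)).

(** [Pi] is linear, so the sum over i can be taken inside it: the c_i g^([y] + i + 1) add up to
    g^[y] * g * [Pi_inv g c]. *)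
Lemma f_linE c y x : fc c (row_mx y x) = dotp (mult c y) x.
Proof.
rewrite ffunE /dotp; under eq_bigr => i _ do
  rewrite ffunE row_mxKl row_mxKr /dotp mulr_sumr.
rewrite exchange_big /=; apply: eq_bigr => j _.
rewrite mxE /Pi_inv !mulr_sumr linear_sum mulr_suml; apply: eq_bigr => i _.
by rewrite mxE -!scalerAr linearZ -exprS -exprD mulrA.
Qed.

Lemma mult_inj c : c != 0 -> injective (mult c).
Proof.
move=> c_neq0 y z /Pi_inj/mulIf; rewrite mulf_neq0 ?prim_neq0 ?Pi_inv_eq0 //.
move=> /(_ isT)/eqP; rewrite (eq_prim_root_expr prim_g).
(* Hence 2^s <= 2^t - 1, so both exponents lie below the order of [g] and equal powers force equal
   exponents. *)
have s_le : (2 ^ s * 2 <= 2 ^ t)%N by rewrite -expnSr leq_exp2l.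
have ly := nat_of_vec_lt y; have lz := nat_of_vec_lt z.
by rewrite !modn_small; [move=> /eqP/nat_of_vec_inj|lia..].
Qed.

Lemma mult0 y : mult 0 y = 0.
Proof.
by rewrite /mult Pi_inv0 !mulr0; apply/rowP=> i; rewrite !mxE linear0.
Qed.

Lemma mult_neq0 c y : c != 0 -> mult c y != 0.
Proof.
move=> c_neq0; rewrite -(mult0 y) (inj_eq Pi_inj) Pi_inv0 !mulr0.
by rewrite !mulf_neq0 ?expf_neq0 ?prim_neq0 ?Pi_inv_eq0.
Qed.

Lemma f_linD c e z : fc (c + e) z = fc c z + fc e z.
Proof.
by rewrite !ffunE -big_split; apply: eq_bigr => i _; rewrite mxE mulrDl.
Qed.

Lemma linD b b' a d z :
  @lin s t (b + b') (a + d) z = lin b a z + lin b' d z.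
Proof. by rewrite !ffunE !dotpDl addrACA. Qed.

(** * Correlation of f_c with linear functions *)

Definition corr c b a : int := \sum_z sgn (fc c z + lin b a z).

Lemma corrE c b a :
  corr c b a = \sum_y sgn (dotp b y) * (if mult c y == a then 2 ^+ t else 0).
Proof.
rewrite /corr sum_row_mx; apply: eq_bigr => y _.
rewrite -addr_eq0_F2 -sum_sgn_dotp mulr_sumr; apply: eq_bigr => x _.
by rewrite f_linE ffunE row_mxKl row_mxKr addrCA sgnD dotpDl.
Qed.

Lemma corr_mult c b y : c != 0 -> corr c b (mult c y) = sgn (dotp b y) * 2 ^+ t.
Proof.
move=> c_neq0; rewrite corrE (bigD1 y) //= eqxx big1 ?addr0 // => z zy.
by rewrite (inj_eq (mult_inj c_neq0)) (negbTE zy) mulr0.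
Qed.

Lemma corr_out c b a : (forall y, mult c y != a) -> corr c b a = 0.
Proof.
by move=> nya; rewrite corrE big1 // => y _; rewrite (negbTE (nya y)) mulr0.
Qed.

Lemma corr_cases c b a : c != 0 -> corr c b a \in [:: 0; 2 ^+ t; - 2 ^+ t].
Proof.
move=> c_neq0; have [/existsP[y /eqP <-]|/existsPn out] :=
  boolP [exists y, mult c y == a]; last by rewrite corr_out ?inE ?eqxx.
rewrite corr_mult // !inE.
by case: (sgn_cases (dotp b y)) => ->; rewrite ?mulN1r ?mul1r eqxx ?orbT.
Qed.

Lemma corr0 b a : corr 0 b a = if (a == 0) && (b == 0) then 2 ^+ (s + t) else 0.
Proof.
rewrite corrE; under eq_bigr => y _ do rewrite mult0.
rewrite -mulr_suml sum_sgn_dotp [0 == a]eq_sym exprD.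
by case: (a == 0); case: (b == 0); rewrite ?mulr0 ?mul0r.
Qed.

(** * The sequences of S_{c,a} and their orthogonality *)

Definition Sseq c b a : sequence (s + t) :=
  seq_mul (seq_of (fc c)) (seq_of (lin b a)).

Lemma SseqE c b a z : Sseq c b a z = sgn (fc c z + lin b a z).
Proof. by rewrite !ffunE -sgnD. Qed.

Lemma S_setP c a u : reflect (exists b, u = Sseq c b a) (u \in S c a).
Proof.
apply: (iffP (imfsetP _ _ _ _)) => [[l /imsetP[b _ ->] ->]|[b ->]].
  by exists b.
by exists (lin b a) => //; apply: imset_f.
Qed.

(** f_c is additive in c and [lin b a] in (b, a), so the product of two such sequences is again one,
    with summed parameters. *)
Lemma orthogonal_SseqE c e b b' a d :
  orthogonal_seq (Sseq c b a) (Sseq e b' d) = (corr (c + e) (b + b') (a + d) == 0).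
Proof.
congr (_ == _); apply: eq_bigr => z _.
by rewrite !SseqE -sgnD f_linD linD addrACA.
Qed.

Lemma walsh_Sseq c b a (w : 'rV['F_2]_(s + t)) :
  walsh [ffun z => fc c z + lin b a z] w =
  corr c (lsubmx w + b) (rsubmx w + a).
Proof.
apply: eq_bigr => z _; rewrite linD ffunE; congr sgn.
rewrite addrAC -addrA; congr (_ + (_ + _)).
rewrite ffunE -{1}[w]hsubmxK -{1}[z]hsubmxK /dotp big_split_ord /=.
by congr (_ + _); apply: eq_bigr => i _; rewrite ?row_mxEl ?row_mxEr.
Qed.

Lemma perpP c e a d :
  reflect (forall b, corr (c + e) b (a + d) = 0) (perp (S c a) (S e d)).
Proof.
apply: (iffP idP) => [/forallP SS b|corr0].
  (* Pairing with the single sequence b' = 0 of the second set already makes b + b' run over all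
     vectors. *)
  have uS : Sseq c b a \in S c a by apply/S_setP; exists b.
  have vS : Sseq e 0 d \in S e d by apply/S_setP; exists 0.
  have /forallP/(_ [` vS]%fset) := SS [` uS]%fset.
  by rewrite /= orthogonal_SseqE addr0 => /eqP.
apply/forallP=> -[u /= /S_setP[b ->]]; apply/forallP=> -[v /= /S_setP[b' ->]].
by rewrite orthogonal_SseqE corr0.
Qed.

Lemma perp_neqE c e a d : c != e ->
  perp (S c a) (S e d) = ~~ [exists y, mult (c + e) y == a + d].
Proof.
move=> ce; have ce0 : c + e != 0 by rewrite addr_eq0_F2.
apply/perpP/existsPn => [corr0 y|out b]; last exact: corr_out.
(* A solution y of [mult (c + e) y = a + d] would give, at b = 0, the nonzero correlation 2^t. *)
apply/eqP=> ya; have /eqP := corr0 0.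
by rewrite -ya corr_mult // !mulf_eq0 !expf_eq0 /= !andbF.
Qed.

Lemma perp_eqE c a d : perp (S c a) (S c d) = (a != d).
Proof.
rewrite -addr_eq0_F2; apply/perpP/idP => [/(_ 0)|/negbTE ad b].
  rewrite addrr_F2 corr0 eqxx andbT; case: (_ == _) => // /eqP.
  by rewrite expf_eq0 andbF.
by rewrite addrr_F2 corr0 ad.
Qed.

(** * Powers of g and the exponent i_c *)

Lemma powP z : z != 0 -> exists2 k, (k < (2 ^ t).-1)%N & z = g ^+ k.
Proof.
(* The counting is moved through [Pi] to the finite type of row vectors: the 2^t - 1 distinct powers
   avoid 0, hence exhaust the nonzero elements. *)
move=> z_neq0; pose X := [set Pi t g (g ^+ i) | i : 'I_(2 ^ t).-1].
have Pi0 : Pi t g 0 = 0 by apply/rowP=> i; rewrite !mxE linear0.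
have defX : X = [set~ 0].
  apply/eqP; rewrite eqEcard; apply/andP; split.
    apply/subsetP=> _ /imsetP[i _ ->]; rewrite !inE -Pi0 (inj_eq Pi_inj).
    by rewrite expf_neq0 ?prim_neq0.
  rewrite cardsC1 card_rVF2 card_imset ?card_ord // => i j /Pi_inj/eqP.
  by rewrite (eq_prim_root_expr prim_g) !modn_small // => /eqP/val_inj.
have : Pi t g z \in X by rewrite defX !inE -Pi0 (inj_eq Pi_inj).
by case/imsetP=> k _ /Pi_inj ->; exists k.
Qed.

(** By [powP] the search in the list of powers succeeds, so [i_] never takes its out-of-range value
    here. *)
Lemma exp_i c : c != 0 -> g ^+ i_ g c = g * Pi_inv g c.
Proof.
move=> c_neq0; rewrite /i_; set w := \sum_i _.
have wE : g * Pi_inv g c = w.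
  by rewrite mulr_sumr; apply: eq_bigr => i _; rewrite -scalerAr exprS.
rewrite wE; set r := [seq _ | _ <- _].
have [k kn wk] : exists2 k, (k < (2 ^ t).-1)%N & w = g ^+ k.
  by apply: powP; rewrite -wE mulf_neq0 ?prim_neq0 ?Pi_inv_eq0.
have wr : w \in r.
  by rewrite wk; apply: map_f; rewrite mem_iota.
have lt_iw : (index w r < (2 ^ t).-1)%N.
  by have := wr; rewrite -index_mem size_map size_iota.
have := nth_index 0 wr.
by rewrite (nth_map 0%N) ?size_iota // nth_iota.
Qed.

Lemma mem_pow_set c v : c != 0 ->
  (Pi_inv g v \in pow_set s g (i_ g c)) = [exists y, mult c y == v].
Proof.
move=> c_neq0; apply/imageP/existsP => [[y _ vE]|[y /eqP <-]]; exists y => //.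
  by rewrite /mult -exp_i // -exprD -vE Pi_invK.
by rewrite /mult PiK // -exp_i // exprD.
Qed.

(** * Counting the orthogonal sets *)

(** Makes counting sets in (iv) the same as counting pairs. For c = e, a set is not orthogonal to
    itself. For c != e, a common sequence would force a correlation 2^(s+t), which differs from 0
    and +-2^t because s > 0. *)
Lemma S_set_inj (s_gt0 : (0 < s)%N) c e a d : S c a = S e d -> (c, a) = (e, d).
Proof.
move=> SE; have [ce|ce] := eqVneq c e.
  have := perp_eqE e a d; rewrite -{1}ce SE perp_eqE eqxx ce.
  by move/esym/eqP => ->.
have ce0 : c + e != 0 by rewrite addr_eq0_F2.
have : Sseq c 0 a \in S e d by rewrite -SE; apply/S_setP; exists 0.
case/S_setP=> b uv.
have := corr_cases b (a + d) ce0.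
have -> : corr (c + e) b (a + d) = 2 ^+ (s + t).
  rewrite /corr (eq_bigr (fun=> 1)) ?sumr_const ?card_rVF2 ?natrX // => z _.
  rewrite -[b]add0r f_linD linD addrACA sgnD -!SseqE uv SseqE.
  by case: (sgn_cases (fc e z + lin b d z)) => ->.
have st_neq : (2 ^ (s + t) != 2 ^ t)%N by rewrite eqn_exp2l //; lia.
have st_gt0 : (0 < 2 ^ (s + t))%N by rewrite expn_gt0.
by rewrite -!natrX !inE; move: st_neq st_gt0; move: (2 ^ _)%N (2 ^ _)%N; lia.
Qed.

Lemma card_perp e d :
  #|[set p | perp (S p.1 p.2) (S e d)]| =
  ((2 ^ t - 1) * (2 ^ t - 2 ^ s) + (2 ^ t - 1))%N.
Proof.
rewrite -sum1_card (eq_bigl (fun p => perp (S p.1 p.2) (S e d))); last first.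
  by move=> p; rewrite inE.
rewrite -(pair_big_dep xpredT (fun c a => perp (S c a) (S e d)) (fun _ _ => 1%N)) /=.
rewrite (bigD1 e) //= addnC; congr addn.
  rewrite (eq_bigr (fun=> (2 ^ t - 2 ^ s)%N)) => [|c ce].
    rewrite sum_nat_const; congr muln.
    by rewrite subn1 -card_rVF2 -(cardC1 e); apply: eq_card.
  (* The excluded [a] form the translate by [d] of the image of [mult (c + e)], which has 2^s
     elements by injectivity. *)
  rewrite (eq_bigl (mem (~: [set mult (c + e) y + d | y : 'rV['F_2]_s]))).
    rewrite sum1_card cardsCs setCK card_rVF2 card_imset ?card_rVF2 //.
    by apply: inj_comp (addIr d) (mult_inj _); rewrite addr_eq0_F2.
  move=> a; rewrite perp_neqE // !inE; congr negb.
  apply/existsP/imsetP=> [[y /eqP ya]|[y _ ->]]; exists y => //.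
    by rewrite ya addrK_F2.
  by rewrite addrK_F2.
rewrite (eq_bigl (predC1 d)) => [|a]; last by rewrite perp_eqE.
by rewrite sum1_card cardC1 card_rVF2 subn1.
Qed.

End Correlation.

Theorem theorem1 (m s t : nat) (hm : (3 <= m)%N)
    (hs : s = ((m - 1) %/ 2)%N) (ht : t = ((m + 2) %/ 2)%N)
    (L : fieldExtType 'F_2) (hL : \dim {:L} = t)
    (g : L) (hg : ((2 ^ t).-1).-primitive_root g) :
  let S : 'rV['F_2]_t -> 'rV['F_2]_t -> {fset sequence (s + t)} :=
    @S_set L s t g in
  [/\ m = (s + t)%N,
      (forall c a : 'rV['F_2]_t, c != 0 ->
         {in S c a, forall u, semi_bent_seq u}),
      (forall c a : 'rV['F_2]_t, orthogonal_set (S c a)),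
      [/\ (forall c e a d : 'rV['F_2]_t, c != e ->
             perp (S c a) (S e d) <->
             Pi_inv g (a + d) \notin pow_set s g (i_ g (c + e))),
          (forall c e a : 'rV['F_2]_t, c != e -> perp (S c a) (S e a))
        & (forall c a a' : 'rV['F_2]_t, a != a' -> perp (S c a) (S c a'))]
    & (forall e d : 'rV['F_2]_t,
         #|` [fset X in @S_family L s t g | perp X (S e d)]%fset | =
         (if odd m then 2 ^ m + 2 ^ ((m - 1) %/ 2) - 1
          else 3 * 2 ^ m + 2 ^ (m %/ 2 - 1) - 1)%N)].
Proof.
have s_gt0 : (0 < s)%N by lia.
have st : (s < t)%N by lia.
have mE : m = (s + t)%N by lia.
(* The exponent in the definition of semi-bent is t, matching the correlation values +-2^t. *)
have half : ((s + t).+2./2 = t)%N by lia.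
move=> S; split=> //.
- move=> c a c_neq0 u /S_setP[b ->].
  exists [ffun z => f_lin s g c z + lin b a z].
    by apply/ffunP=> z; rewrite SseqE !ffunE.
  by move=> w; rewrite half walsh_Sseq corr_cases.
- move=> c a u v /S_setP[b ->] /S_setP[b' ->] uv.
  have bb' : b != b' by apply: contraNneq uv => ->.
  by rewrite orthogonal_SseqE !addrr_F2 corr0 eqxx addr_eq0_F2 (negbTE bb').
- split=> [c e a d ce|c e a ce|c a a' aa'].
  + by rewrite perp_neqE // mem_pow_set // addr_eq0_F2.
  + rewrite perp_neqE // addrr_F2; apply/existsPn => y.
    by rewrite mult_neq0 // addr_eq0_F2.
  + by rewrite perp_eqE.
move=> e d.
have S_inj : injective (fun p => S p.1 p.2).
  by move=> [c a] [c' a'] /(S_set_inj hL hg st s_gt0).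
have -> : [fset X in @S_family L s t g | perp X (S e d)]%fset =
          [fset S p.1 p.2 | p in [set p | perp (S p.1 p.2) (S e d)]]%fset.
  apply/fsetP=> X; rewrite !inE; apply/andP/imfsetP => /=.
    by case=> /imfsetP[p _ ->] ep; exists p; rewrite ?inE.
  case=> p; rewrite inE => ep ->; rewrite ep; split=> //.
  by apply/imfsetP; exists p; rewrite ?inE.
rewrite card_imfset //= -cardE (card_perp hL hg st).
(* With N = 2^s, 2^t is 2N for odd m and 4N for even m, so the count is 2N^2 + N - 1 or 12N^2 + N -
   1. *)
case: ifP => odd_m.
  have -> : ((m - 1) %/ 2 = s)%N by lia.
  have -> : m = (s + s).+1 by lia.
  have -> : t = s.+1 by lia.
  rewrite !expnS expnD; have : (0 < 2 ^ s)%N by rewrite expn_gt0.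
  by move: (2 ^ s)%N => N; nia.
have -> : (m %/ 2 - 1 = s)%N by lia.
have -> : m = (s + s).+2 by lia.
have -> : t = s.+2 by lia.
rewrite !expnS expnD; have : (0 < 2 ^ s)%N by rewrite expn_gt0.
by move: (2 ^ s)%N => N; nia.
Qed.
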